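(* There exist $f,g,h\in\mathbf{L}$ such that $f\star(g\sqcup h)\ne(f\star g)\sqcup(f\star h)$.
   Context: Let $I=[0,1]$ and let $\mathbf{M}$ be the set of all maps $I\to I$; $\wedge,\vee$ denote minimum and maximum of real numbers. A function $f\in\mathbf{M}$ is normal if $\sup\{f(x)\mid x\in I\}=1$, and convex if $f(y)\ge f(x)\wedge f(z)$ whenever $0\le x\le y\le z\le 1$. $\mathbf{L}$ is the set of all normal and convex $f\in\mathbf{M}$. For $B\subseteq I$, $\bm{1}_B$ is the characteristic function of $B$. For $f,g\in\mathbf{M}$ define $(f\sqcup g)(x)=\sup\{f(y)\wedge g(z)\mid y\vee z=x\}$ (join-convolution; $\mathbf{L}$ is closed under $\sqcup$). For $f\in\mathbf{M}$ let $f^{L}(x)=\sup\{f(y)\mid y\le x\}$ and $f^{R}(x)=\sup\{f(y)\mid y\ge x\}$. The binary operation $\star:\mathbf{L}^2\to\mathbf{M}$ is defined as follows (it is known to take values in $\mathbf{L}$). If $f=\bm{1}_{\{1\}}$, then $f\star g=g\star f=g$. If $f\ne\bm{1}_{\{1\}}$ and $g\ne\bm{1}_{\{1\}}$, then $$(f\star g)(t)=\begin{cases} f^{L}(t)\vee g^{L}(t), & t\in[0,\eta),\\ 1, & t\in[\eta,\xi),\\ f^{R}(\xi)\wedge g^{R}(\xi), & t=\xi,\\ 0, & t\in(\xi,1],\end{cases}$$ where $\eta=\inf\{x\in I\mid f^{L}(x)=1\}\wedge\inf\{x\in I\mid g^{L}(x)=1\}$ and $\xi=\sup\{x\in I\mid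 f^{R}(x)=1\}\wedge\sup\{x\in I\mid g^{R}(x)=1\}$ (one always has $\eta\le\xi$). *)

(* Defs.v *)
From HB Require Import structures.
From mathcomp Require Import all_boot all_order all_algebra.
From mathcomp Require Import interval_inference boolp classical_sets reals.

Set Implicit Arguments.
Unset Strict Implicit.
Unset Printing Implicit Defensive.

Import Order.TTheory GRing.Theory Num.Theory.
Local Open Scope classical_set_scope.
Local Open Scope ring_scope.

Section Defs.
Variable R : realType.

Local Notation I := {i01 R}.

Definition M := I -> I.

(* Suprema and infima are taken in the complete lattice I, so the empty set
   has supremum 0 and infimum 1; see supIP and infIP. *)
Definition supI (A : set I) : I := supremum 0%:i01 A.
Definition infI (A : set I) : I := infimum 1%:i01 A.

Lemma supIP (A : set I) : supremums A (supI A).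
Proof.
rewrite /supI /supremum; case: ifPn => [/eqP ->|/set0P A0].
  by split=> [x []|x _] //; rewrite -num_le ge0.
have hs : has_sup (Itv.r @` A).
  split; first by case: A0 => a Aa; exists a%:num, a.
  by exists 1 => _ [a _ <-]; exact: le1.
have s0 : 0 <= sup (Itv.r @` A).
  case: A0 => a Aa; apply: (@le_trans _ _ a%:num); first exact: ge0.
  by apply: ub_le_sup; [case: hs | exists a].
have s1 : sup (Itv.r @` A) <= 1.
  by apply: ge_sup; [case: hs | move=> _ [a _ <-]; exact: le1].
apply: (@xgetPex _ _ (supremums A)); exists (Itv01 s0 s1); split.
  by move=> a Aa; rewrite -num_le /=; apply: ub_le_sup; [case: hs | exists a].
move=> y uy; rewrite -num_le /=; apply: ge_sup; first by case: hs.
by move=> _ [a Aa <-]; have := uy _ Aa; rewrite -num_le.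
Qed.

Lemma infIP (A : set I) : infimums A (infI A).
Proof.
rewrite /infI /infimum; case: ifPn => [/eqP ->|/set0P A0].
  by split=> [x []|x _] //; rewrite -num_le le1.
apply: (@xgetPex _ _ (infimums A)); exists (supI (lbound A)).
have [ub lub] := supIP (lbound A).
by split=> // a Aa; apply: lub => b; apply.
Qed.

Definition normal (f : M) : Prop := supI (range f) = 1%:i01.

Definition convex (f : M) : Prop :=
  forall x y z : I, x <= y -> y <= z -> Num.min (f x) (f z) <= f y.

Definition L : set M := [set f | normal f /\ convex f].

Definition chi (B : set I) : M :=
  fun x => if `[< B x >] then 1%:i01 else 0%:i01.

Definition joinconv (f g : M) : M := fun x =>
  supI [set w | exists y z : I, Num.max y z = x /\ w = Num.min (f y) (g z)].

Definition lsup (f : M) : M := fun x => supI [set f y | y in [set y | y <= x]].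

Definition rsup (f : M) : M := fun x => supI [set f y | y in [set y | x <= y]].

Definition eta (f g : M) : I :=
  Num.min (infI [set x | lsup f x = 1%:i01]) (infI [set x | lsup g x = 1%:i01]).

Definition xi (f g : M) : I :=
  Num.min (supI [set x | rsup f x = 1%:i01]) (supI [set x | rsup g x = 1%:i01]).

(* Meant on L only; the same formula is used as a total function on M.  On L
   one has eta f g <= xi f g, so the four cases are disjoint and the order in
   which they are tested is immaterial. *)
Definition star (f g : M) : M :=
  if `[< f = chi [set 1%:i01] >] then g
  else if `[< g = chi [set 1%:i01] >] then f
  else fun t =>
    if t < eta f g then Num.max (lsup f t) (lsup g t)
    else if t < xi f g then 1%:i01
    else if t == xi f g then Num.min (rsup f (xi f g)) (rsup g (xi f g))
    else 0%:i01.

End Defs.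

Arguments L {R}.

(* Main.v *)
Require Import Defs.
From HB Require Import structures.
From mathcomp Require Import all_boot all_order all_algebra.
From mathcomp Require Import interval_inference boolp classical_sets reals.

(** The counterexample exploits that $\eta$ is an infimum which need not be
    attained.  Take [f x = x], [h x = x \/ 1/2], and [g] the characteristic
    function of $(0,1]$, and evaluate both sides at 0.

    All three functions are nondecreasing with value 1 at 1, a class on which
    the operations become simple: [lsup] is the identity, [rsup] is constantly
    1, hence $\xi = 1$, the join-convolution is the pointwise minimum
    ([joinconv_topped]), and, away from the neutral element, [star] is the
    pointwise maximum below $\eta$ and 1 from $\eta$ on ([star_topped]).

    Although [g 0 = 0], points where [g] is 1 accumulate at 0, so that
    $\eta = 0$ for the pair [f, g] and [star f g] jumps to 1 at 0.  On the right
    this leaves the value $1 \wedge (f(0) \vee h(0)) = 1/2$ at 0.  On the left,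
    $g \sqcup h = g \wedge h$ reaches 1 only at 1, so $\eta = 1$ and the value
    at 0 is $f(0) \vee (g(0) \wedge h(0)) = 0$. *)

Set Implicit Arguments.
Unset Strict Implicit.
Unset Printing Implicit Defensive.

Import Order.TTheory GRing.Theory Num.Theory.
Local Open Scope classical_set_scope.
Local Open Scope ring_scope.

Section UnitInterval.
Variable R : realType.
Local Notation I := {i01 R}.
Implicit Types (A : set I) (x y z m : I) (f g : M R).

Lemma i01_ge0 x : 0%:i01 <= x. Proof. by rewrite -num_le ge0. Qed.

Lemma i01_le1 x : x <= 1%:i01. Proof. by rewrite -num_le le1. Qed.

Lemma supI_max A m : A m -> ubound A m -> supI A = m.
Proof.
move=> Am ubm; have [ubs lubs] := supIP A.
by apply/le_anti; rewrite (lubs _ ubm) (ubs _ Am).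
Qed.

Lemma infI_eq A m :
  lbound A m -> (forall y, lbound A y -> y <= m) -> infI A = m.
Proof.
move=> lbm glbm; have [lbi glbi] := infIP A.
by apply/le_anti; rewrite (glbm _ lbi) (glbi _ lbm).
Qed.

Definition topped f := {homo f : x y / x <= y} /\ f 1%:i01 = 1%:i01.

Lemma topped_L f : topped f -> L f.
Proof.
move=> [ndf f1]; split.
  by apply: supI_max => [|y _]; [exists 1%:i01 | exact: i01_le1].
by move=> x y z /ndf fxy _; rewrite ge_min fxy.
Qed.

Lemma lsup_topped f x : topped f -> lsup f x = f x.
Proof.
move=> [ndf _]; apply: supI_max; first by exists x => /=.
by move=> _ [y /= yx <-]; exact: ndf.
Qed.

Lemma rsup_topped f x : topped f -> rsup f x = 1%:i01.
Proof.
move=> [_ f1]; apply: supI_max => [|y _]; last exact: i01_le1.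
by exists 1%:i01 => //=; exact: i01_le1.
Qed.

(** The pair [y = z = x] is optimal, since enlarging either argument up to [x]
    can only increase the values. *)
Lemma joinconv_topped f g x :
  topped f -> topped g -> joinconv f g x = Num.min (f x) (g x).
Proof.
move=> [ndf _] [ndg _]; apply: supI_max.
  by exists x, x; rewrite maxxx.
move=> _ [y [z [<- ->]]].
by apply: le_min2; [apply: ndf | apply: ndg]; rewrite le_max lexx ?orbT.
Qed.

Lemma topped_joinconv f g : topped f -> topped g -> topped (joinconv f g).
Proof.
move=> tf tg; split=> [x y xy|]; rewrite !joinconv_topped //.
  by apply: le_min2; [apply: tf.1 | apply: tg.1].
by rewrite tf.2 tg.2 minxx.
Qed.

Lemma eta_topped f g : topped f -> topped g ->
  Defs.eta f g =
    Num.min (infI [set x | f x = 1%:i01]) (infI [set x | g x = 1%:i01]).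
Proof.
move=> tf tg; rewrite /Defs.eta.
by congr (Num.min (infI _) (infI _)); apply/seteqP; split=> x /=;
  rewrite lsup_topped.
Qed.

Lemma xi_topped f g : topped f -> topped g -> xi f g = 1%:i01.
Proof.
have sup1 k : topped k -> supI [set x | rsup k x = 1%:i01] = 1%:i01.
  move=> tk; apply: supI_max => [|y _]; last exact: i01_le1.
  by rewrite /= rsup_topped.
by move=> tf tg; rewrite /xi !sup1 // minxx.
Qed.

Lemma neq_chi1 f x : x != 1%:i01 -> f x != 0%:i01 -> f <> chi [set 1%:i01].
Proof.
move=> /eqP x1 /eqP fx0 fE; apply: fx0.
by rewrite fE /chi asboolF.
Qed.

(** As $\xi = 1$, the last case of the definition of [star] is void, and the
    case [t = 1] gives 1 because [rsup] is constantly 1. *)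
Lemma star_topped f g t : topped f -> topped g ->
  f <> chi [set 1%:i01] -> g <> chi [set 1%:i01] ->
  star f g t = if t < Defs.eta f g then Num.max (f t) (g t) else 1%:i01.
Proof.
move=> tf tg f1 g1; rewrite /star asboolF // asboolF //.
rewrite xi_topped // !lsup_topped // !rsup_topped // minxx.
case: ifP => // _; case: ltP => // t1.
by rewrite (@le_anti _ _ t 1%:i01) ?eqxx // i01_le1.
Qed.

Lemma topped_star f g : topped f -> topped g ->
  f <> chi [set 1%:i01] -> g <> chi [set 1%:i01] -> topped (star f g).
Proof.
move=> tf tg f1 g1; split=> [x y xy|]; rewrite !star_topped //; last first.
  by rewrite ltNge i01_le1.
have [yeta|_] := ltP y (Defs.eta f g); last exact: i01_le1.
by rewrite (le_lt_trans xy yeta); apply: le_max2; [apply: tf.1 | apply: tg.1].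
Qed.

Lemma infI_only1 f : f 1%:i01 = 1%:i01 ->
  (forall x, f x = 1%:i01 -> x = 1%:i01) -> infI [set x | f x = 1%:i01] = 1%:i01.
Proof.
move=> f1 only1; apply: infI_eq => [x /= /only1 -> //|y _]; exact: i01_le1.
Qed.

Lemma halve_ge0 x : 0 <= x%:num / 2.
Proof. by rewrite divr_ge0. Qed.

Lemma halve_le1 x : x%:num / 2 <= 1.
Proof. by rewrite ler_pdivrMr // mul1r (le_trans (le1 x)) // ler1n. Qed.

Definition halve x : I := Itv01 (halve_ge0 x) (halve_le1 x).

Lemma halve_gt0 x : 0%:i01 < x -> 0%:i01 < halve x.
Proof. by rewrite -!num_lt /= => x0; rewrite divr_gt0. Qed.

Lemma halve_lt x : 0%:i01 < x -> halve x < x.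
Proof.
by rewrite -!num_lt /= => x0; rewrite ltr_pdivrMr // mulr_natr mulr2n ltrDl.
Qed.

Definition half : I := halve 1%:i01.

Lemma half_gt0 : 0%:i01 < half.
Proof. by apply: halve_gt0; rewrite -num_lt /=. Qed.

Lemma half_lt1 : half < 1%:i01.
Proof. by apply: halve_lt; rewrite -num_lt /=. Qed.

Definition chi_pos : M R := chi [set x | 0%:i01 < x].

Definition max_half : M R := fun x => Num.max x half.

Lemma topped_id : topped (id : M R). Proof. by split. Qed.

Lemma chi_pos_gt0 x : 0%:i01 < x -> chi_pos x = 1%:i01.
Proof. by move=> x0; rewrite /chi_pos /chi asboolT. Qed.

Lemma chi_pos0 : chi_pos 0%:i01 = 0%:i01.
Proof. by rewrite /chi_pos /chi asboolF //= ltxx. Qed.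

Lemma topped_chi_pos : topped chi_pos.
Proof.
split=> [x y xy|]; last exact: chi_pos_gt0 (lt_trans half_gt0 half_lt1).
have [y0|] := ltP 0%:i01 y; first by rewrite (chi_pos_gt0 y0) i01_le1.
move=> y0; have -> : x = y; last exact: lexx.
by apply/le_anti; rewrite xy (le_trans y0 (i01_ge0 x)).
Qed.

Lemma topped_max_half : topped max_half.
Proof.
split=> [x y xy|]; first exact: le_max2.
by rewrite /max_half; apply/max_idPl; exact: i01_le1.
Qed.

Lemma max_half_only1 x : max_half x = 1%:i01 -> x = 1%:i01.
Proof.
rewrite /max_half; case: (leP x half) => // _ h1.
by have := half_lt1; rewrite h1 ltxx.
Qed.

(** The infimum is not attained: a positive lower bound [y] would exceed
    [halve y], where [chi_pos] is still 1. *)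
Lemma infI_chi_pos : infI [set x | chi_pos x = 1%:i01] = 0%:i01.
Proof.
apply: infI_eq => [x _|y lby]; first exact: i01_ge0.
rewrite leNgt; apply/negP => y0.
have := lby _ (chi_pos_gt0 (halve_gt0 y0)).
by rewrite leNgt halve_lt.
Qed.

End UnitInterval.

Theorem theorem6 (R : realType) :
  exists f g h : M R,
    L f /\ L g /\ L h /\
    star f (joinconv g h) <> joinconv (star f g) (star f h).
Proof.
have half1 := half_lt1 R; have half0 := half_gt0 R.
have half_neq1 : half R != 1%:i01 by rewrite lt_eqF.
have half_neq0 : half R != 0%:i01 by rewrite gt_eqF.
have gt01 : 0%:i01 < 1%:i01 :> {i01 R} := lt_trans half0 half1.
set g := @chi_pos R; set h := @max_half R.
have tf : topped (id : M R) := topped_id R; have tg : topped g := topped_chi_pos R.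
have th : topped h := topped_max_half R; have tgh := topped_joinconv tg th.
have gh_half : joinconv g h (half R) = half R.
  rewrite joinconv_topped // /g chi_pos_gt0 // /h /max_half maxxx.
  by apply/min_idPr; exact: i01_le1.
have gh_only1 x : joinconv g h x = 1%:i01 -> x = 1%:i01.
  rewrite joinconv_topped // => gh1; apply: max_half_only1.
  by apply/le_anti; rewrite i01_le1 -gh1 ge_min lexx orbT.
have f_neq : id <> chi [set 1%:i01] :> M R by apply: neq_chi1 half_neq1 _.
have g_neq : g <> chi [set 1%:i01].
  by apply: neq_chi1 half_neq1 _; rewrite /g chi_pos_gt0 // gt_eqF.
have h_neq : h <> chi [set 1%:i01].
  by apply: neq_chi1 half_neq1 _; rewrite /h /max_half maxxx.
have gh_neq : joinconv g h <> chi [set 1%:i01].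
  by apply: neq_chi1 half_neq1 _; rewrite gh_half.
have inf_id : infI [set x : {i01 R} | id x = 1%:i01] = 1%:i01.
  exact: (@infI_only1 R id).
have eta_fg : Defs.eta id g = 0%:i01.
  rewrite eta_topped // infI_chi_pos; apply/min_idPr; exact: i01_ge0.
have eta_fh : Defs.eta id h = 1%:i01.
  rewrite eta_topped // inf_id infI_only1 ?minxx //; first exact: th.2.
  exact: max_half_only1.
have eta_fgh : Defs.eta id (joinconv g h) = 1%:i01.
  by rewrite eta_topped // inf_id infI_only1 ?minxx //; exact: tgh.2.
exists id, g, h; do 3![split; first exact: topped_L].
move=> /(congr1 (fun k : M R => k 0%:i01)).
rewrite (joinconv_topped _ (topped_star tf tg _ _) (topped_star tf th _ _)) //.
rewrite !star_topped // eta_fg eta_fh eta_fgh ltxx gt01.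
rewrite joinconv_topped // /g chi_pos0 /h /max_half.
rewrite (max_idPr (i01_ge0 (half R))) (min_idPl (i01_ge0 (half R))) maxxx.
rewrite (max_idPr (i01_ge0 (half R))) (min_idPr (i01_le1 (half R))) => half_eq0.
by rewrite -half_eq0 eqxx in half_neq0.
Qed.
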